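(* The following hold: 1. $\mathsf{K}_\geq\leq_{\mathrm{sW}}\mathsf{G}\leq_{\mathrm{sW}}\mathsf{K}\leq_{\mathrm{sW}}\mathsf{K}'\equiv_{\mathrm{sW}}\mathsf{C}_{\mathbb N}'$, 2. $\mathsf{G}_\geq\leq_{\mathrm{sW}}\mathsf{LPO}^{*}<_{\mathrm W}\mathsf{C}_{\mathbb N}$.
   Context: Weihrauch complexity. $f:\subseteq X\rightrightarrows Y$ denotes a partial multivalued map. A represented space $(X,\delta_X)$ is a set $X$ with a surjective partial map $\delta_X:\subseteq\mathbb N^{\mathbb N}\to X$. A partial function $F:\subseteq\mathbb N^{\mathbb N}\to\mathbb N^{\mathbb N}$ is a realizer of $f:\subseteq X\rightrightarrows Y$, written $F\vdash f$, if $\delta_YF(p)\in f(\delta_X(p))$ for all $p\in\mathrm{dom}(f\delta_X)$. A problem is a multivalued map on represented spaces that has a realizer. $\mathbb N^{\mathbb N}$, $\mathbb N$ and products carry the standard representations; $\langle\cdot\rangle$ denotes standard pairing/tupling. $f\leq_{\mathrm W}g$ holds if there are computable $H,L:\subseteq\mathbb N^{\mathbb N}\to\mathbb N^{\mathbb N}$ such that $H\langle\mathrm{id},\Gamma L\rangle\vdash f$ whenever $\Gamma\vdash g$; $f\leq_{\mathrm{sW}}g$ holds if there are computable $H,L$ such that $H\Gamma L\vdash f$ whenever $\Gamma\vdash g$. $\equiv_{\mathrm W},\equiv_{\mathrm{sW}}$ are the corresponding equivalences, and $f<_{\mathrm W}g$ means $f\leq_{\mathrm W}g$ and $g\not\leq_{\mathrm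 W}f$. Jump: for a problem $f:\subseteq X\rightrightarrows Y$, with $\delta$ the representation of $X$, the jump $f'$ is the same multivalued map but with the input space represented by $\delta'=\delta\circ\lim$, where $\lim:\subseteq\mathbb N^{\mathbb N}\to\mathbb N^{\mathbb N}$, $\lim\langle p_0,p_1,\dots\rangle=\lim_{n\to\infty}p_n$. Finite parallelization: $f^{*}$ takes as input a number $n\in\mathbb N$ together with $(x_1,\dots,x_n)\in\mathrm{dom}(f)^n$ and returns $n$ and any element of $f(x_1)\times\dots\times f(x_n)$. Gödel problem and variants. $\varphi$ is a fixed standard (acceptable) Gödel numbering of the partial computable functions $\subseteq\mathbb N\to\mathbb N$. - $\mathsf{G}:\subseteq\mathbb N^{\mathbb N}\rightrightarrows\mathbb N$, $\mathsf{G}(p)=\{i\in\mathbb N:\varphi_i=p\}$, with domain the set of all (total) computable sequences $p\in\mathbb N^{\mathbb N}$. - $\mathsf{K}:\subseteq\mathbb N^{\mathbb N}\to\mathbb N$, $\mathsf{K}(p)=\min\mathsf{G}(p)$, $\mathrm{dom}(\mathsf K)=\mathrm{dom}(\mathsf G)$ (Kolmogorov complexity). - $\mathsf{G}_\geq:\subseteq\mathbb N^{\mathbb N}\times\mathbb N\rightrightarrows\mathbb N$, $\mathsf{G}_\geq(p,m)=\mathsf{G}(p)$, with domain $\{(p,m):p\in\mathrm{dom}(\mathsf G),\ m\geq\mathsf{K}(p)\}$. - $\mathsf{K}_\geq:\subseteq\mathbb N^{\mathbb N}\rightrightarrows\mathbb N$, $\mathsf{K}_\geq(p)=\{m\in\mathbb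 N:m\geq\mathsf{K}(p)\}$, $\mathrm{dom}(\mathsf K_\geq)=\mathrm{dom}(\mathsf G)$. Other problems. - $\mathsf{C}_{\mathbb N}:\subseteq\mathbb N^{\mathbb N}\rightrightarrows\mathbb N$, $\mathsf{C}_{\mathbb N}(p)=\{n\in\mathbb N:(\forall k)\ p(k)\neq n\}$, with domain $\{p:\mathrm{range}(p)\subsetneqq\mathbb N\}$ (closed choice). - $\mathsf{LPO}:\mathbb N^{\mathbb N}\to\{0,1\}$, $\mathsf{LPO}(p)=1$ if and only if $p$ is the constant zero sequence. *)

(* Defs.v *)
From Stdlib Require Import Arith Lia List Cantor.
From Stdlib Require Import FunctionalExtensionality ClassicalEpsilon.

Definition baire := nat -> nat.

Record pfun (X Y : Type) := PFun {
  graph :> X -> Y -> Prop;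
  graph_functional : forall x y y', graph x y -> graph x y' -> y = y'
}.
Arguments PFun {X Y} graph graph_functional.
Arguments graph {X Y} p _ _.
Arguments graph_functional {X Y} p {x y y'} _ _.

Definition npair (x y : nat) : nat := Cantor.to_nat (x, y).
Definition nfst (z : nat) : nat := fst (Cantor.of_nat z).
Definition nsnd (z : nat) : nat := snd (Cantor.of_nat z).

(* [bpair p q] is the sequence p(0), q(0), p(1), q(1), ... *)
Definition bpair (p q : baire) : baire :=
  fun n => if Nat.even n then p (Nat.div2 n) else q (Nat.div2 n).
Definition bfst (r : baire) : baire := fun n => r (2 * n).
Definition bsnd (r : baire) : baire := fun n => r (2 * n + 1).

(* The i-th component of a countable tuple: [<p_0,p_1,...>(<i,k>) = p_i(k)]. *)
Definition component (r : baire) (i : nat) : baire := fun k => r (npair i k).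
Definition btuple (ps : nat -> baire) : baire := fun n => ps (nfst n) (nsnd n).

Definition pcomp {X Y Z} (G : pfun Y Z) (F : pfun X Y) : pfun X Z.
Proof.
  refine (PFun (fun x z => exists y, F x y /\ G y z) _).
  intros x z z' [y [Fy Gz]] [y' [Fy' Gz']].
  rewrite <- (graph_functional F Fy Fy') in Gz'.
  exact (graph_functional G Gz Gz').
Defined.

(* The map <id, F>. *)
Definition pid_pair (F : pfun baire baire) : pfun baire baire.
Proof.
  refine (PFun (fun p r => exists q, F p q /\ r = bpair p q) _).
  intros p r r' [q [Fq ->]] [q' [Fq' ->]].
  now rewrite (graph_functional F Fq Fq').
Defined.

(* Partial recursive functions relative to an oracle, in the unary presentation
   where several arguments are packed with the Cantor bijection. *)
Inductive code :=
| CZero | CSucc | CFst | CSnd | COracle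
| CPair (f g : code)
| CComp (f g : code)
| CPrec (f g : code)
| CMu (f : code).

Fixpoint rec_graph (base : nat -> Prop) (step : nat -> nat -> nat -> Prop)
    (n : nat) : nat -> Prop :=
  match n with
  | 0 => base
  | S m => fun y => exists r, rec_graph base step m r /\ step m r y
  end.

(* [eval c p x y]: the program [c] with oracle [p] halts on [x] with output [y].
   [CPrec f g] is h(a,0) = f(a), h(a,m+1) = g(a,(m,h(a,m))), and [CMu f] maps
   [a] to the least [n] with f(a,n) = 0, all earlier values being defined. *)
Fixpoint eval (c : code) (p : baire) (x y : nat) {struct c} : Prop :=
  match c with
  | CZero => y = 0
  | CSucc => y = S x
  | CFst => y = nfst x
  | CSnd => y = nsnd x
  | COracle => y = p x
  | CPair f g => exists u v, eval f p x u /\ eval g p x v /\ y = npair u v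
  | CComp f g => exists u, eval g p x u /\ eval f p u y
  | CPrec f g =>
      rec_graph (eval f p (nfst x))
        (fun m r s => eval g p (npair (nfst x) (npair m r)) s) (nsnd x) y
  | CMu f =>
      eval f p (npair x y) 0 /\
      forall m, m < y -> exists k, eval f p (npair x m) (S k)
  end.

(* Computability on Baire space only constrains the program on the domain. *)
Definition computable (F : pfun baire baire) : Prop :=
  exists c, forall p q, F p q -> forall n, eval c p n (q n).

(* For number functions the domains have to agree; the constant zero oracle is
   interchangeable with having no oracle at all. *)
Definition partial_computable (f : nat -> nat -> Prop) : Prop :=
  exists c, forall x y, f x y <-> eval c (fun _ => 0) x y.

Definition total_computable (s : nat -> nat) : Prop :=
  partial_computable (fun x y => y = s x).

Definition numbering := nat -> nat -> nat -> Prop.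

(* Acceptable numberings: [phi i x y] stands for phi_i(x) = y.  The first clause
   gives a computable universal function (hence every phi_i is single-valued
   and partial computable), the second the s-m-n property (hence every partial
   computable function is some phi_i). *)
Record acceptable (phi : numbering) : Prop := {
  acceptable_utm :
    partial_computable (fun z y => phi (nfst z) (nsnd z) y);
  acceptable_smn :
    forall psi, partial_computable psi ->
    exists s, total_computable s /\
      forall i x y, phi (s i) x y <-> psi (npair i x) y
}.

Record repspace := RepSpace {
  carrier :> Type;
  rep : pfun baire carrier;
  rep_surj : forall x, exists p, rep p x
}.

Lemma bfst_bpair p q : bfst (bpair p q) = p.
Proof.
  apply functional_extensionality; intro n; unfold bfst, bpair.
  rewrite Nat.div2_double, Nat.even_mul; reflexivity.
Qed.

Lemma bsnd_bpair p q : bsnd (bpair p q) = q.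
Proof.
  apply functional_extensionality; intro n; unfold bsnd, bpair.
  rewrite Nat.even_add, Nat.even_mul, Nat.add_1_r, Nat.div2_succ_double.
  reflexivity.
Qed.

Lemma component_btuple ps i : component (btuple ps) i = ps i.
Proof.
  apply functional_extensionality; intro k.
  unfold component, btuple, nfst, nsnd, npair.
  now rewrite Cantor.cancel_of_to.
Qed.

Definition baire_space : repspace.
Proof.
  unshelve refine (RepSpace baire (PFun (fun p q => q = p) _) _).
  - intros p x x' -> ->; reflexivity.
  - intro q; now exists q.
Defined.

Definition nat_space : repspace.
Proof.
  unshelve refine (RepSpace nat (PFun (fun p n => n = p 0) _) _).
  - intros p x x' -> ->; reflexivity.
  - intro n; now exists (fun _ => n).
Defined.

(* {0,1} as a subspace of the natural numbers. *)
Definition bool_space : repspace.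
Proof.
  unshelve refine (RepSpace bool (PFun (fun p b => Nat.b2n b = p 0) _) _).
  - intros p [] []; simpl; intros; (reflexivity || lia).
  - intro b; now exists (fun _ => Nat.b2n b).
Defined.

Definition prod_space (X Y : repspace) : repspace.
Proof.
  unshelve refine (RepSpace (X * Y)
    (PFun (fun r z => rep X (bfst r) (fst z) /\ rep Y (bsnd r) (snd z)) _) _).
  - intros r [x y] [x' y'] [Hx Hy] [Hx' Hy']; simpl in *.
    now rewrite (graph_functional _ Hx Hx'), (graph_functional _ Hy Hy').
  - intros [x y].
    destruct (rep_surj X x) as [p Hp], (rep_surj Y y) as [q Hq].
    exists (bpair p q); simpl; now rewrite bfst_bpair, bsnd_bpair.
Defined.

(* The finite sequences over [X], i.e. pairs of a number n and an n-tuple.  A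
   name consists of n followed by a tuple whose components 0, ..., n-1 are
   names of the entries; its other components are ignored. *)
Definition seq_space (X : repspace) : repspace.
Proof.
  unshelve refine (RepSpace (list X)
    (PFun (fun p s =>
       Forall2 (rep X)
         (map (component (fun k => p (S k))) (seq 0 (p 0))) s) _) _).
  - intros p; generalize (map (component (fun k => p (S k))) (seq 0 (p 0))).
    intros l s s' H; revert s'.
    induction H as [|q x l s Hx _ IH]; intros s' H'; inversion H'; subst.
    + reflexivity.
    + f_equal; [eapply graph_functional; eassumption | now apply IH].
  - intro s.
    assert (E : exists ps : nat -> baire,
               Forall2 (rep X) (map ps (seq 0 (length s))) s).
    { induction s as [|x s [ps IH]].
      - exists (fun _ _ => 0); constructor.
      - destruct (rep_surj X x) as [p Hp].
        exists (fun i => match i with 0 => p | S j => ps j end); simpl.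
        constructor; [exact Hp|].
        now rewrite <- seq_shift, map_map. }
    destruct E as [ps Hps].
    exists (fun n => match n with 0 => length s | S k => btuple ps k end).
    simpl; erewrite map_ext; [exact Hps|].
    intro i; apply component_btuple.
Defined.

(* The limit map on Baire space, for the product topology. *)
Definition blim : pfun baire baire.
Proof.
  refine (PFun (fun p q => forall k, exists N, forall n, N <= n ->
                  component p n k = q k) _).
  intros p q q' H H'; apply functional_extensionality; intro k.
  destruct (H k) as [N HN], (H' k) as [N' HN'].
  rewrite <- (HN (N + N')), <- (HN' (N + N')) by lia; reflexivity.
Defined.

Definition jump_space (X : repspace) : repspace.
Proof.
  unshelve refine (RepSpace X (pcomp (rep X) blim) _).
  intro x; destruct (rep_surj X x) as [p Hp].
  exists (btuple (fun _ => p)), p; split; [|exact Hp].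
  intro k; exists 0; intros n _; now rewrite component_btuple.
Defined.

(* A partial multivalued map, given by its graph: f(x) = {y | f x y}, and the
   domain is the set of [x] with nonempty f(x). *)
Record problem := Problem {
  source : repspace;
  target : repspace;
  values :> source -> target -> Prop
}.

Definition dom (f : problem) (x : source f) : Prop := exists y, f x y.

Definition realizes (F : pfun baire baire) (f : problem) : Prop :=
  forall p x, rep (source f) p x -> dom f x ->
  exists q y, F p q /\ rep (target f) q y /\ f x y.

(* Hence [problem] needs no field asking for a realizer. *)
Lemma problem_has_realizer (f : problem) : exists F, realizes F f.
Proof.
  pose (good p q := exists x y, rep (source f) p x /\ rep (target f) q y /\ f x y).
  pose (val p := epsilon (inhabits p) (good p)).
  assert (Hfun : forall p q q' : baire, good p q /\ q = val p ->
            good p q' /\ q' = val p -> q = q') by (intros; intuition congruence).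
  exists (PFun (fun p q => good p q /\ q = val p) Hfun).
  intros p x Hp [y Hy].
  destruct (rep_surj _ y) as [q Hq].
  assert (Hgood : good p (val p)).
  { apply epsilon_spec; exists q, x, y; auto. }
  pose proof Hgood as Hgood'.
  destruct Hgood' as [x' [y' [Hp' [Hq' Hf]]]].
  rewrite <- (graph_functional _ Hp Hp') in Hf.
  exists (val p), y'; simpl; auto.
Qed.

Definition W_le (f g : problem) : Prop :=
  exists H L : pfun baire baire, computable H /\ computable L /\
  forall Gamma, realizes Gamma g ->
    realizes (pcomp H (pid_pair (pcomp Gamma L))) f.

Definition sW_le (f g : problem) : Prop :=
  exists H L : pfun baire baire, computable H /\ computable L /\
  forall Gamma, realizes Gamma g -> realizes (pcomp H (pcomp Gamma L)) f.

Definition sW_equiv (f g : problem) : Prop := sW_le f g /\ sW_le g f.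
Definition W_lt (f g : problem) : Prop := W_le f g /\ ~ W_le g f.

Notation "f <=sW g" := (sW_le f g) (at level 70).
Notation "f ==sW g" := (sW_equiv f g) (at level 70).
Notation "f <W g" := (W_lt f g) (at level 70).

Definition jump (f : problem) : problem :=
  Problem (jump_space (source f)) (target f) (values f).

Definition star (f : problem) : problem :=
  Problem (seq_space (source f)) (seq_space (target f)) (Forall2 (values f)).

Definition goedel_number (phi : numbering) (p : baire) (i : nat) : Prop :=
  forall x y, phi i x y <-> p x = y.

Definition complexity (phi : numbering) (p : baire) (k : nat) : Prop :=
  goedel_number phi p k /\ forall i, goedel_number phi p i -> k <= i.

Definition G (phi : numbering) : problem :=
  Problem baire_space nat_space (goedel_number phi).

Definition K (phi : numbering) : problem :=
  Problem baire_space nat_space (complexity phi).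

Definition G_ge (phi : numbering) : problem :=
  Problem (prod_space baire_space nat_space) nat_space
    (fun pm i => (exists k, complexity phi (fst pm) k /\ k <= snd pm) /\
                 goedel_number phi (fst pm) i).

Definition K_ge (phi : numbering) : problem :=
  Problem baire_space nat_space
    (fun p m => exists k, complexity phi p k /\ k <= m).

Definition C_N : problem :=
  Problem baire_space nat_space (fun p n => forall k, p k <> n).

Definition LPO : problem :=
  Problem baire_space bool_space (fun p b => b = true <-> forall n, p n = 0).

(* Main.v *)
From Stdlib Require Import Arith Lia List Cantor.
From Stdlib Require Import FunctionalExtensionality ClassicalEpsilon.
Require Import Defs.

(** The Goedel numbering enters through computable stages [step] that converge
    to [final] (a [staging]), so a reduction to a jump only has to exhibit total
    [recursive] stages that converge pointwise.

    Any index of p is a bound for the least one, and the least index is an index;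
    so the identity reduces [K_ge] to [G] and [G] to [K].  A constant sequence of names converges, so
    every problem reduces to its jump.

    Given p as a limit, halting is decided in the limit too, and relative to this
    limit the set of indices of p is co-enumerable.  Choosing the least index together
    with a bound for the mismatches of all smaller ones is then a closed choice
    ([jump_K_le_jump_C_N]).  Conversely, let q be given as a limit, and let a
    guess at a number outside its range move up from 0, one step whenever the
    guess turns out to be enumerated.  It changes finitely often.  The sequence of guesses, modified after each change at t so
    as to differ from the programs up to t, is computable because the
    modifications are finitely many, and its complexity exceeds the time of the
    last change.  As the sequence can be recomputed from its index, its
    complexity alone yields the final guess ([jump_C_N_le_jump_K]).

    Given a bound m for the complexity of p, one question for each index up to m
    tells whether that program ever contradicts p.  The programs that never do
    agree with p wherever they are defined, and one of them is total, so their
    union is an index of p ([G_ge_le_star_LPO]).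

    Finitely many questions are answered by choosing a place before which every
    nonzero sequence has a nonzero entry ([star_LPO_le_C_N]).  In the other
    direction a reduction would have finitely many possible answers, the number
    of questions being fixed on a neighbourhood; near a suitable input the
    answers are constant, and then the chosen number depends continuously on the
    input, which allows it to be enumerated afterwards ([C_N_not_le_star_LPO]).
*)

(** * Pairing and uniform bounds *)

Lemma nfst_npair x y : nfst (npair x y) = x.
Proof. unfold nfst, npair; now rewrite Cantor.cancel_of_to. Qed.

Lemma nsnd_npair x y : nsnd (npair x y) = y.
Proof. unfold nsnd, npair; now rewrite Cantor.cancel_of_to. Qed.

Hint Rewrite nfst_npair nsnd_npair : npair.

Lemma npair_surjective z : npair (nfst z) (nsnd z) = z.
Proof.
  unfold npair, nfst, nsnd; rewrite <- surjective_pairing.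
  apply Cantor.cancel_to_of.
Qed.

Lemma npair_le x y b : x <= b -> y <= b -> npair x y <= b + (b + b) * S (b + b).
Proof.
  intros Hx Hy; pose proof (Cantor.to_nat_spec x y) as E; unfold npair; nia.
Qed.

Lemma least_witness (P : nat -> Prop) :
  (exists n, P n) -> exists n, P n /\ forall m, P m -> n <= m.
Proof.
  intros [n Hn]; induction n as [n IH] using lt_wf_ind.
  destruct (classic (exists m, m < n /\ P m)) as [[m [Hm HP]]|H].
  - exact (IH m Hm HP).
  - exists n; split; [exact Hn|]; intros m HP.
    destruct (le_lt_dec n m); [assumption|]; exfalso; eauto.
Qed.

Lemma uniform_bound (P : nat -> nat -> Prop) n :
  (forall m N N', N <= N' -> P m N -> P m N') ->
  (forall m, m < n -> exists N, P m N) -> exists N, forall m, m < n -> P m N.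
Proof.
  intros Hmono; induction n as [|n IH]; intros H.
  - exists 0; lia.
  - destruct IH as [N HN]; [intros; apply H; lia|].
    destruct (H n) as [N' HN']; [lia|].
    exists (N + N'); intros m Hm.
    destruct (Nat.eq_dec m n) as [->|].
    + apply Hmono with N'; [lia | assumption].
    + apply Hmono with N; [lia | apply HN; lia].
Qed.

(** * Programs *)

Lemma rec_graph_functional base step :
  (forall y y', base y -> base y' -> y = y') ->
  (forall m r y y', step m r y -> step m r y' -> y = y') ->
  forall n y y', rec_graph base step n y -> rec_graph base step n y' -> y = y'.
Proof.
  intros Hb Hs n; induction n as [|n IH]; simpl; intros y y'.
  - apply Hb.
  - intros [r [Hr Hy]] [r' [Hr' Hy']].
    rewrite (IH _ _ Hr' Hr) in Hy'; eauto.
Qed.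

Lemma eval_functional c p x y y' : eval c p x y -> eval c p x y' -> y = y'.
Proof.
  revert x y y'; induction c; simpl; intros x y y'; try congruence.
  - intros (u & v & Hu & Hv & ->) (u' & v' & Hu' & Hv' & ->).
    f_equal; eauto.
  - intros (u & Hu & Hy) (u' & Hu' & Hy').
    rewrite (IHc2 _ _ _ Hu' Hu) in Hy'; eauto.
  - apply rec_graph_functional; eauto.
  - intros [H0 Hlt] [H0' Hlt'].
    destruct (lt_eq_lt_dec y y') as [[Hl|]|Hl]; [|assumption|].
    + destruct (Hlt' _ Hl) as [k Hk]; discriminate (IHc _ _ _ H0 Hk).
    + destruct (Hlt _ Hl) as [k Hk]; discriminate (IHc _ _ _ H0' Hk).
Qed.

(** A halting computation asks its oracle only finitely many questions. *)
Lemma eval_continuous c p x y :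
  eval c p x y ->
  exists N, forall p', (forall k, k < N -> p' k = p k) -> eval c p' x y.
Proof.
  revert x y; induction c; simpl; intros x y.
  1-4: now exists 0.
  - intros ->; exists (S x); intros p' H; symmetry; apply H; lia.
  - intros (u & v & Hu & Hv & ->).
    destruct (IHc1 _ _ Hu) as [N HN], (IHc2 _ _ Hv) as [N' HN'].
    exists (N + N'); intros p' H; exists u, v; repeat split.
    + apply HN; intros; apply H; lia.
    + apply HN'; intros; apply H; lia.
  - intros (u & Hu & Hy).
    destruct (IHc2 _ _ Hu) as [N HN], (IHc1 _ _ Hy) as [N' HN'].
    exists (N + N'); intros p' H; exists u; split.
    + apply HN; intros; apply H; lia.
    + apply HN'; intros; apply H; lia.
  - generalize (nsnd x) as n; intros n; revert y.
    induction n as [|n IH]; simpl; intros y; [apply IHc1|].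
    intros (r & Hr & Hy).
    destruct (IH _ Hr) as [N HN], (IHc2 _ _ Hy) as [N' HN'].
    exists (N + N'); intros p' H; exists r; split.
    + apply HN; intros; apply H; lia.
    + apply HN'; intros; apply H; lia.
  - intros [H0 Hlt].
    destruct (IHc _ _ H0) as [N0 HN0].
    destruct (uniform_bound (fun m N => forall p',
      (forall k, k < N -> p' k = p k) -> exists k, eval c p' (npair x m) (S k))
      y) as [N HN].
    + intros m N N' Hle HN p' H; apply HN; intros; apply H; lia.
    + intros m Hm; destruct (Hlt m Hm) as [k Hk].
      destruct (IHc _ _ Hk) as [N HN]; exists N; eauto.
    + exists (N0 + N); intros p' H; split.
      * apply HN0; intros; apply H; lia.
      * intros m Hm; apply HN; [assumption|]; intros; apply H; lia.
Qed.

(** The zero oracle can be replaced by the zero program, so computability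
    without an oracle is preserved when some other oracle is present. *)
Fixpoint erase (c : code) : code :=
  match c with
  | COracle => CZero
  | CPair f g => CPair (erase f) (erase g)
  | CComp f g => CComp (erase f) (erase g)
  | CPrec f g => CPrec (erase f) (erase g)
  | CMu f => CMu (erase f)
  | _ => c
  end.

Lemma eval_erase c p x y : eval c (fun _ => 0) x y -> eval (erase c) p x y.
Proof.
  revert x y; induction c; simpl; intros x y; auto.
  - intros (u & v & Hu & Hv & ->); exists u, v; auto.
  - intros (u & Hu & Hy); exists u; auto.
  - generalize (nsnd x) as n; intros n; revert y.
    induction n as [|n IH]; simpl; intros y; [apply IHc1|].
    intros (r & Hr & Hy); exists r; auto.
  - intros [H0 Hlt]; split; [auto|].
    intros m Hm; destruct (Hlt m Hm) as [k Hk]; exists k; auto.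
Qed.

(** * Total recursive functionals *)

Definition recursive (F : baire -> nat -> nat) : Prop :=
  exists c, forall p x, eval c p x (F p x).

Lemma recursive_ext F F' :
  (forall p x, F p x = F' p x) -> recursive F -> recursive F'.
Proof. intros E [c Hc]; exists c; intros p x; rewrite <- E; apply Hc. Qed.

Lemma recursive_id : recursive (fun p x => x).
Proof.
  exists (CPair CFst CSnd); intros p x; simpl.
  exists (nfst x), (nsnd x); now rewrite npair_surjective.
Qed.

Lemma recursive_apply F A :
  recursive F -> recursive A -> recursive (fun p x => F p (A p x)).
Proof.
  intros [f Hf] [a Ha]; exists (CComp f a); intros p x; simpl.
  exists (A p x); auto.
Qed.

Lemma recursive_S A : recursive A -> recursive (fun p x => S (A p x)).
Proof.
  intros [a Ha]; exists (CComp CSucc a); intros p x; simpl; eauto.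
Qed.

Lemma recursive_const k : recursive (fun p x => k).
Proof.
  induction k as [|k IH]; [exists CZero; reflexivity|].
  exact (recursive_S _ IH).
Qed.

Lemma recursive_nfst A : recursive A -> recursive (fun p x => nfst (A p x)).
Proof.
  intros [a Ha]; exists (CComp CFst a); intros p x; simpl; eauto.
Qed.

Lemma recursive_nsnd A : recursive A -> recursive (fun p x => nsnd (A p x)).
Proof.
  intros [a Ha]; exists (CComp CSnd a); intros p x; simpl; eauto.
Qed.

Lemma recursive_oracle A : recursive A -> recursive (fun p x => p (A p x)).
Proof.
  intros [a Ha]; exists (CComp COracle a); intros p x; simpl; eauto.
Qed.

Lemma recursive_npair A B :
  recursive A -> recursive B -> recursive (fun p x => npair (A p x) (B p x)).
Proof.
  intros [a Ha] [b Hb]; exists (CPair a b); intros p x; simpl.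
  exists (A p x), (B p x); auto.
Qed.

Lemma recursive_nat_rect B St N :
  recursive B ->
  recursive (fun p z => St p (nfst z) (nfst (nsnd z)) (nsnd (nsnd z))) ->
  recursive N ->
  recursive (fun p x => nat_rect (fun _ => nat) (B p x) (St p x) (N p x)).
Proof.
  intros [b Hb] [s Hs] HN.
  destruct (recursive_npair _ _ recursive_id HN) as [n Hn].
  exists (CComp (CPrec b s) n); intros p x.
  exists (npair x (N p x)); split; [apply Hn|]; simpl.
  rewrite nfst_npair, nsnd_npair.
  induction (N p x) as [|k IH]; simpl; [apply Hb|].
  eexists; split; [exact IH|].
  specialize (Hs p (npair x (npair k
    (nat_rect (fun _ => nat) (B p x) (St p x) k)))).
  now rewrite nsnd_npair, !nfst_npair, nsnd_npair in Hs.
Qed.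

Definition ifz (a b c : nat) : nat := match a with 0 => b | S _ => c end.
Definition isz (a : nat) : nat := ifz a 1 0.
Definition dist (a b : nat) : nat := (a - b) + (b - a).
Definition bsum (f : nat -> nat) (n : nat) : nat :=
  nat_rect (fun _ => nat) 0 (fun m r => r + f m) n.

Lemma isz_zero a : isz a = 0 <-> a <> 0.
Proof. destruct a; unfold isz; simpl; lia. Qed.

Lemma dist_zero a b : dist a b = 0 <-> a = b.
Proof. unfold dist; lia. Qed.

Lemma bsum_zero f n : bsum f n = 0 <-> forall m, m < n -> f m = 0.
Proof.
  induction n as [|n IH]; simpl; [split; lia|].
  unfold bsum in *; simpl; rewrite Nat.eq_add_0, IH; split.
  - intros [H E] m Hm; destruct (Nat.eq_dec m n) as [->|]; [exact E|].
    apply H; lia.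
  - intros H; split; [intros m Hm|]; apply H; lia.
Qed.

Lemma bsum_nonzero f n : bsum f n <> 0 <-> exists m, m < n /\ f m <> 0.
Proof.
  rewrite bsum_zero; split.
  - intros H; apply NNPP; intros H'; apply H; intros m Hm.
    apply NNPP; intros E; eauto.
  - intros (m & Hm & E) H; apply E, H, Hm.
Qed.

(** [prove_recursive] follows the syntax of a functional.  The two hooks are
    filled once the closure lemmas of further operations have been proved. *)
Ltac recursive_step := fail.
Ltac stage_step := fail.
Ltac prove_recursive :=
  cbv beta;
  first
    [ assumption
    | simple apply recursive_id
    | simple apply recursive_const
    | simple apply recursive_S; prove_recursive
    | simple apply recursive_nfst; prove_recursive
    | simple apply recursive_nsnd; prove_recursive
    | simple apply recursive_npair; prove_recursive
    | simple apply recursive_nat_rect; prove_recursive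
    | recursive_step; prove_recursive
    | stage_step; prove_recursive
    | simple apply recursive_oracle; prove_recursive ].

Lemma recursive_pred A : recursive A -> recursive (fun p x => pred (A p x)).
Proof.
  intros HA; apply recursive_ext with (fun p x =>
    nat_rect (fun _ => nat) 0 (fun m _ => m) (A p x)).
  - intros p x; now destruct (A p x).
  - prove_recursive.
Qed.

Lemma recursive_ifz A B C :
  recursive A -> recursive B -> recursive C ->
  recursive (fun p x => ifz (A p x) (B p x) (C p x)).
Proof.
  intros HA HB HC; apply recursive_ext with (fun p x =>
    nat_rect (fun _ => nat) (B p x) (fun _ _ => C p x) (A p x)).
  - intros p x; now destruct (A p x).
  - apply recursive_nat_rect; [assumption| |assumption].
    exact (recursive_apply _ _ HC (recursive_nfst _ recursive_id)).
Qed.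

Lemma recursive_add A B :
  recursive A -> recursive B -> recursive (fun p x => A p x + B p x).
Proof.
  intros HA HB; apply recursive_ext with (fun p x =>
    nat_rect (fun _ => nat) (A p x) (fun _ r => S r) (B p x)).
  - intros p x; induction (B p x) as [|n IH]; simpl; lia.
  - prove_recursive.
Qed.

Lemma recursive_sub A B :
  recursive A -> recursive B -> recursive (fun p x => A p x - B p x).
Proof.
  intros HA HB; apply recursive_ext with (fun p x =>
    nat_rect (fun _ => nat) (A p x) (fun _ r => pred r) (B p x)).
  - intros p x; induction (B p x) as [|n IH]; simpl; lia.
  - apply recursive_nat_rect; [assumption| |assumption].
    apply recursive_pred; prove_recursive.
Qed.

Lemma recursive_bsum F N :
  recursive (fun p z => F p (nfst z) (nsnd z)) -> recursive N ->
  recursive (fun p x => bsum (F p x) (N p x)).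
Proof.
  intros HF HN; apply recursive_nat_rect; [prove_recursive| |assumption].
  apply recursive_add; [prove_recursive|].
  apply recursive_ext with (fun p z => F p
    (nfst (npair (nfst z) (nfst (nsnd z))))
    (nsnd (npair (nfst z) (nfst (nsnd z))))).
  - intros p x; now rewrite nfst_npair, nsnd_npair.
  - apply (recursive_apply _ (fun p z => npair (nfst z) (nfst (nsnd z))) HF).
    prove_recursive.
Qed.

Lemma recursive_component I A :
  recursive I -> recursive A ->
  recursive (fun p x => component p (I p x) (A p x)).
Proof. intros HI HA; unfold component; prove_recursive. Qed.

Lemma recursive_bfst A : recursive A -> recursive (fun p x => bfst p (A p x)).
Proof.
  intros HA; apply recursive_ext with (fun p x => p (A p x + A p x)).
  - intros p x; unfold bfst; f_equal; lia.
  - apply recursive_oracle, recursive_add; assumption.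
Qed.

Lemma recursive_bsnd A : recursive A -> recursive (fun p x => bsnd p (A p x)).
Proof.
  intros HA; apply recursive_ext with (fun p x => p (S (A p x + A p x))).
  - intros p x; unfold bsnd; f_equal; lia.
  - apply recursive_oracle, recursive_S, recursive_add; assumption.
Qed.

Ltac recursive_step ::=
  first
    [ simple apply recursive_pred
    | simple apply recursive_ifz
    | simple apply recursive_add
    | simple apply recursive_sub
    | simple apply recursive_bsum
    | simple apply recursive_component
    | simple apply recursive_bfst
    | simple apply recursive_bsnd
    | progress unfold isz
    | progress unfold dist ].

(** Tables: the finitely many exceptional values are coded into the program. *)
Lemma recursive_eventually_constant (f : nat -> nat) N v :
  (forall n, N <= n -> f n = v) -> recursive (fun _ => f).
Proof.
  revert f; induction N as [|N IH]; intros f H.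
  - apply recursive_ext with (fun _ _ => v); [|apply recursive_const].
    intros p x; symmetry; apply H; lia.
  - apply recursive_ext with (fun _ x => ifz x (f 0) (f (S (pred x)))).
    + intros p [|x]; reflexivity.
    + apply recursive_ifz; [prove_recursive|prove_recursive|].
      apply (recursive_apply (fun _ n => f (S n)) (fun _ x => pred x)).
      * apply IH; intros n Hn; apply H; lia.
      * prove_recursive.
Qed.

Lemma recursive_of_total_computable s :
  total_computable s -> recursive (fun _ => s).
Proof.
  intros [c Hc]; exists (erase c); intros p x.
  now apply eval_erase, Hc.
Qed.

Lemma eval_CMu c F p x :
  (forall z, eval c p z (F z)) -> (exists y, F (npair x y) = 0) ->
  exists y, eval (CMu c) p x y /\ F (npair x y) = 0.
Proof.
  intros Hc HF; destruct (least_witness _ HF) as (y & Hy & Hmin).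
  exists y; split; [|exact Hy]; simpl; split; [rewrite <- Hy; apply Hc|].
  intros m Hm; exists (pred (F (npair x m))).
  rewrite Nat.succ_pred; [apply Hc|].
  intros E; apply Hmin in E; lia.
Qed.

(** * Stages of a computation *)

(** The state is 0 while no zero of [f] has been met, 1 once an undefined value
    has blocked the search, and [S (S n)] once the zero [n] has been found; here
    [f] itself has values 0 for undefined and [S v] for [v]. *)
Definition search (f : nat -> nat) (n : nat) : nat :=
  nat_rect (fun _ => nat) 0
    (fun m r => ifz r (ifz (f m) 1 (ifz (pred (f m)) (S (S m)) 0)) r) n.

(** Only the code of the universal function will be run, so no interpreter for
    coded programs is needed: each code has a simulation of its own, by recursion
    on the code.  [run c x s] is [S y] if [c] with zero oracle outputs [y] on [x]
    when all unbounded searches are cut off at [s], and 0 if it has no output. *)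
Fixpoint run (c : code) (x s : nat) : nat :=
  match c with
  | CZero => 1
  | CSucc => S (S x)
  | CFst => S (nfst x)
  | CSnd => S (nsnd x)
  | COracle => 1
  | CPair f g =>
      ifz (run f x s) 0 (ifz (run g x s) 0
        (S (npair (pred (run f x s)) (pred (run g x s)))))
  | CComp f g => ifz (run g x s) 0 (run f (pred (run g x s)) s)
  | CPrec f g =>
      nat_rect (fun _ => nat) (run f (nfst x) s)
        (fun m r => ifz r 0 (run g (npair (nfst x) (npair m (pred r))) s))
        (nsnd x)
  | CMu f => pred (search (fun m => run f (npair x m) s) s)
  end.

Lemma search_blocked f n :
  search f n = 0 -> forall m, m < n -> exists k, f m = S (S k).
Proof.
  induction n as [|n IH]; simpl; [lia|]; fold (search f n).
  destruct (search f n) as [|r]; simpl; [|discriminate].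
  destruct (f n) as [|[|k]] eqn:E; simpl; try discriminate.
  intros _ m Hm; destruct (Nat.eq_dec m n) as [->|]; [eauto|].
  apply IH; lia.
Qed.

Lemma search_sound f n y :
  search f n = S (S y) ->
  f y = 1 /\ forall m, m < y -> exists k, f m = S (S k).
Proof.
  induction n as [|n IH]; simpl; [discriminate|]; fold (search f n).
  destruct (search f n) as [|r] eqn:Er; simpl; [|exact IH].
  destruct (f n) as [|[|k]] eqn:E; simpl; try discriminate.
  intros [= <-]; split; [exact E|]; now apply search_blocked.
Qed.

Lemma search_complete f n y :
  f y = 1 -> (forall m, m < y -> exists k, f m = S (S k)) ->
  y < n -> search f n = S (S y).
Proof.
  intros Hy Hlt.
  assert (H0 : forall m, m <= y -> search f m = 0).
  { induction m as [|m IH]; simpl; [reflexivity|]; fold (search f m); intros H.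
    rewrite IH by lia; destruct (Hlt m) as [k ->]; [lia|]; reflexivity. }
  induction n as [|n IH]; simpl; [lia|]; fold (search f n); intros H.
  destruct (Nat.eq_dec n y) as [->|].
  - rewrite H0, Hy by lia; reflexivity.
  - rewrite IH by lia; reflexivity.
Qed.

Lemma run_sound c x s y : run c x s = S y -> eval c (fun _ => 0) x y.
Proof.
  revert x y; induction c; simpl; intros x y; try congruence.
  - destruct (run c1 x s) as [|u] eqn:Eu; simpl; [discriminate|].
    destruct (run c2 x s) as [|v] eqn:Ev; simpl; [discriminate|].
    intros [= <-]; exists u, v; auto.
  - destruct (run c2 x s) as [|u] eqn:Eu; simpl; [discriminate|].
    intros H; exists u; auto.
  - generalize (nsnd x) as n; intros n; revert y.
    induction n as [|n IH]; simpl; intros y; [apply IHc1|].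
    destruct (nat_rect _ _ _ n) as [|r]; simpl; [discriminate|].
    intros H; exists r; auto.
  - intros H.
    assert (E : search (fun m => run c (npair x m) s) s = S (S y))
      by (destruct (search _ s); simpl in H; congruence).
    apply search_sound in E; destruct E as [E0 Elt]; split; [auto|].
    intros m Hm; destruct (Elt m Hm) as [k Hk]; exists k; auto.
Qed.

Definition converges (u : nat -> nat) (v : nat) : Prop :=
  exists N, forall n, N <= n -> u n = v.

Lemma converges_const v : converges (fun _ => v) v.
Proof. now exists 0. Qed.

Lemma converges_map f u v :
  converges u v -> converges (fun n => f (u n)) (f v).
Proof. intros [N H]; exists N; intros n Hn; now rewrite H. Qed.

Lemma converges_map2 f u u' v v' :
  converges u v -> converges u' v' ->
  converges (fun n => f (u n) (u' n)) (f v v').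
Proof.
  intros [N H] [N' H']; exists (N + N'); intros n Hn.
  rewrite H, H' by lia; reflexivity.
Qed.

Lemma converges_subst (f : nat -> nat -> nat) u a v :
  converges u a -> converges (fun n => f n a) v ->
  converges (fun n => f n (u n)) v.
Proof.
  intros [N H] [N' H']; exists (N + N'); intros n Hn.
  rewrite H by lia; apply H'; lia.
Qed.

Lemma converges_ifz u a v b w c :
  converges u a -> converges v b -> converges w c ->
  converges (fun n => ifz (u n) (v n) (w n)) (ifz a b c).
Proof.
  intros [N H] [N' H'] [N'' H'']; exists (N + N' + N''); intros n Hn.
  rewrite H, H', H'' by lia; reflexivity.
Qed.

Lemma converges_bsum (F : nat -> nat -> nat) f k :
  (forall m, converges (fun n => F n m) (f m)) ->
  converges (fun n => bsum (F n) k) (bsum f k).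
Proof.
  intros H; induction k as [|k IH]; [exact (converges_const 0)|].
  exact (converges_map2 Nat.add _ _ _ _ IH (H k)).
Qed.

Lemma converges_unique u v v' : converges u v -> converges u v' -> v = v'.
Proof.
  intros [N H] [N' H']; rewrite <- (H (N + N')), <- (H' (N + N')); lia.
Qed.

Lemma run_complete c x y :
  eval c (fun _ => 0) x y -> converges (run c x) (S y).
Proof.
  revert x y; induction c; simpl; intros x y.
  1-5: intros ->; apply converges_const.
  - intros (u & v & Hu & Hv & ->).
    apply (converges_map2 (fun a b => ifz a 0 (ifz b 0
      (S (npair (pred a) (pred b))))) _ _ _ _ (IHc1 _ _ Hu) (IHc2 _ _ Hv)).
  - intros (u & Hu & Hy).
    apply (converges_subst (fun s a => ifz a 0 (run c1 (pred a) s)) _ _ _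
      (IHc2 _ _ Hu)); simpl; auto.
  - generalize (nsnd x) as n; intros n; revert y.
    induction n as [|n IH]; simpl; intros y; [apply IHc1|].
    intros (r & Hr & Hy).
    apply (converges_subst (fun s a => ifz a 0
      (run c2 (npair (nfst x) (npair n (pred a))) s)) _ _ _ (IH _ Hr)).
    simpl; auto.
  - intros [H0 Hlt].
    destruct (IHc _ _ H0) as [N0 HN0].
    destruct (uniform_bound (fun m N => forall s, N <= s ->
      exists k, run c (npair x m) s = S (S k)) y) as [N HN].
    + intros m N N' Hle HN s Hs; apply HN; lia.
    + intros m Hm; destruct (Hlt m Hm) as [k Hk].
      destruct (IHc _ _ Hk) as [N HN]; exists N; eauto.
    + exists (S (y + N0 + N)); intros s Hs.
      rewrite (search_complete _ s y); [reflexivity| | |lia].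
      * apply HN0; lia.
      * intros m Hm; apply HN; [assumption|lia].
Qed.

Lemma recursive_search F N :
  recursive (fun p z => F p (nfst z) (nsnd z)) -> recursive N ->
  recursive (fun p x => search (F p x) (N p x)).
Proof.
  intros HF HN.
  assert (HF' : recursive (fun p z => F p (nfst z) (nfst (nsnd z)))).
  { apply recursive_ext with (fun p z => F p
      (nfst (npair (nfst z) (nfst (nsnd z))))
      (nsnd (npair (nfst z) (nfst (nsnd z))))).
    - intros p x; now rewrite nfst_npair, nsnd_npair.
    - apply (recursive_apply _ (fun p z => npair (nfst z) (nfst (nsnd z))) HF).
      prove_recursive. }
  apply recursive_nat_rect; [prove_recursive| |assumption].
  prove_recursive.
Qed.

Lemma recursive_run c X T :
  recursive X -> recursive T -> recursive (fun p x => run c (X p x) (T p x)).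
Proof.
  revert X T.
  induction c as [| | | | |f IHf g IHg|f IHf g IHg|f IHf g IHg|f IHf];
    simpl; intros X T HX HT.
  1-5: prove_recursive.
  - pose proof (IHf _ _ HX HT); pose proof (IHg _ _ HX HT); prove_recursive.
  - pose proof (IHg _ _ HX HT).
    apply recursive_ifz; [assumption|prove_recursive|].
    apply IHf; prove_recursive.
  - assert (HX' : recursive (fun p z => X p (nfst z)))
      by (apply (recursive_apply _ _ HX); prove_recursive).
    assert (HT' : recursive (fun p z => T p (nfst z)))
      by (apply (recursive_apply _ _ HT); prove_recursive).
    apply recursive_nat_rect; [apply IHf; prove_recursive| |prove_recursive].
    apply recursive_ifz; [prove_recursive|prove_recursive|].
    apply IHg; prove_recursive.
  - apply recursive_pred.
    apply recursive_search; [|assumption].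
    apply (IHf (fun p z => npair (X p (nfst z)) (nsnd z))
               (fun p z => T p (nfst z))).
    + assert (HX' : recursive (fun p z => X p (nfst z)))
        by (apply (recursive_apply _ _ HX); prove_recursive).
      prove_recursive.
    + apply (recursive_apply _ _ HT); prove_recursive.
Qed.

(** What the reductions use of the Goedel numbering: computable stages
    [step i x s] approximating [phi i x], with limit [final i x], where 0 means
    undefined and [S y] means value [y]. *)
Record staging (phi : numbering) (step : nat -> nat -> nat -> nat)
    (final : nat -> nat -> nat) : Prop := {
  step_recursive : forall I X T, recursive I -> recursive X -> recursive T ->
    recursive (fun p z => step (I p z) (X p z) (T p z));
  step_sound : forall i x s y, step i x s = S y -> phi i x y;
  step_converges : forall i x, converges (step i x) (final i x);
  final_spec : forall i x y, final i x = S y <-> phi i x y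
}.

Ltac stage_step ::=
  match goal with
  | H : staging _ _ _ |- _ => simple apply (step_recursive _ _ _ H)
  end.

Lemma acceptable_staging phi :
  acceptable phi -> exists step final, staging phi step final.
Proof.
  intros Hphi; destruct (acceptable_utm _ Hphi) as [c Hc].
  assert (Hphic : forall i x y,
            phi i x y <-> eval c (fun _ => 0) (npair i x) y).
  { intros i x y; rewrite <- Hc, nfst_npair, nsnd_npair; reflexivity. }
  set (step i x s := run c (npair i x) s).
  assert (Hfinal : forall i x, exists v, converges (step i x) v).
  { intros i x; destruct (classic (exists y, phi i x y)) as [[y Hy]|H].
    - exists (S y); apply run_complete, Hphic, Hy.
    - exists 0, 0; intros s _.
      destruct (step i x s) as [|y] eqn:E; [reflexivity|].
      destruct H; exists y; apply Hphic, (run_sound _ _ _ _ E). }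
  set (final i x := proj1_sig (constructive_indefinite_description _
                                 (Hfinal i x))).
  assert (Hconv : forall i x, converges (step i x) (final i x))
    by (intros i x; apply proj2_sig).
  exists step, final; split.
  - intros I X T HI HX HT; apply recursive_run; prove_recursive.
  - intros i x s y E; apply Hphic, (run_sound _ _ _ _ E).
  - exact Hconv.
  - intros i x y; rewrite Hphic; split; intros H.
    + destruct (Hconv i x) as [N HN]; rewrite <- (HN N) in H by lia.
      exact (run_sound _ _ _ _ H).
    + exact (converges_unique _ _ _ (Hconv i x) (run_complete _ _ _ H)).
Qed.

Lemma numbering_functional phi i x y y' :
  acceptable phi -> phi i x y -> phi i x y' -> y = y'.
Proof.
  intros Hphi H H'; destruct (acceptable_utm _ Hphi) as [c Hc].
  apply (eval_functional c (fun _ => 0) (npair i x)); apply Hc;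
    now rewrite nfst_npair, nsnd_npair.
Qed.

Lemma complexity_exists phi p i :
  goedel_number phi p i -> exists k, complexity phi p k /\ k <= i.
Proof.
  intros Hi; destruct (least_witness (goedel_number phi p)) as (k & Hk & Hmin);
    [eauto|]; exists k; repeat split; auto; apply Hk.
Qed.

Lemma recursive_goedel_number phi p :
  acceptable phi -> recursive (fun _ => p) -> exists i, goedel_number phi p i.
Proof.
  intros Hphi Hp.
  destruct (acceptable_smn _ Hphi (fun z y => p (nsnd z) = y)) as (s & _ & Hs).
  - destruct (recursive_apply (fun _ => p) (fun _ z => nsnd z) Hp) as [c Hc];
      [prove_recursive|].
    exists c; intros z y; split; [intros <-; apply Hc|].
    apply eval_functional, Hc.
  - exists (s 0); intros x y; rewrite Hs, nsnd_npair; reflexivity.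
Qed.

(** * Reductions from programs *)

Definition total_pfun (F : baire -> baire) : pfun baire baire :=
  PFun (fun p q => q = F p) (fun p q q' E E' => eq_trans E (eq_sym E')).

Lemma total_pfun_computable F : recursive F -> computable (total_pfun F).
Proof. intros [c Hc]; exists c; intros p q ->; auto. Qed.

Lemma sW_le_intro (f g : problem) (H : pfun baire baire) (L : baire -> baire) :
  computable H -> recursive L ->
  (forall p x, rep (source f) p x -> dom f x ->
    exists x', rep (source g) (L p) x' /\ dom g x' /\
    forall r y', rep (target g) r y' -> g x' y' ->
    exists q y, H r q /\ rep (target f) q y /\ f x y) ->
  f <=sW g.
Proof.
  intros HH HL Hred; exists H, (total_pfun L); split; [exact HH|].
  split; [now apply total_pfun_computable|].
  intros Gamma HG p x Hp Hx.
  destruct (Hred p x Hp Hx) as (x' & Hx' & Hd & Hout).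
  destruct (HG _ _ Hx' Hd) as (r & y' & Hr & Hy' & Hg).
  destruct (Hout r y' Hy' Hg) as (q & y & Hq & Hy & Hf).
  exists q, y; split; [|now split].
  exists r; split; [exists (L p); now split|exact Hq].
Qed.

Lemma W_le_intro (f g : problem) (H L : baire -> baire) :
  recursive H -> recursive L ->
  (forall p x, rep (source f) p x -> dom f x ->
    exists x', rep (source g) (L p) x' /\ dom g x' /\
    forall r y', rep (target g) r y' -> g x' y' ->
    exists y, rep (target f) (H (bpair p r)) y /\ f x y) ->
  W_le f g.
Proof.
  intros HH HL Hred; exists (total_pfun H), (total_pfun L).
  split; [now apply total_pfun_computable|].
  split; [now apply total_pfun_computable|].
  intros Gamma HG p x Hp Hx.
  destruct (Hred p x Hp Hx) as (x' & Hx' & Hd & Hout).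
  destruct (HG _ _ Hx' Hd) as (r & y' & Hr & Hy' & Hg).
  destruct (Hout r y' Hy' Hg) as (y & Hy & Hf).
  exists (H (bpair p r)), y; split; [|now split].
  exists (bpair p r); split; [|reflexivity].
  exists r; split; [exists (L p); now split|reflexivity].
Qed.

(** * Indices and complexity *)

Lemma K_ge_le_G phi : K_ge phi <=sW G phi.
Proof.
  apply (sW_le_intro _ _ (total_pfun (fun p => p)) (fun p => p)).
  1: apply total_pfun_computable.
  1-2: exact (recursive_oracle _ recursive_id).
  simpl; intros p x -> (m & k & [Hk _] & _).
  exists p; repeat split; [exists k; exact Hk|].
  intros r i -> Hi; exists r, (r 0); repeat split.
  exact (complexity_exists _ _ _ Hi).
Qed.

Lemma G_le_K phi : G phi <=sW K phi.
Proof.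
  apply (sW_le_intro _ _ (total_pfun (fun p => p)) (fun p => p)).
  1: apply total_pfun_computable.
  1-2: exact (recursive_oracle _ recursive_id).
  simpl; intros p x -> [i Hi].
  destruct (complexity_exists _ _ _ Hi) as (k & Hk & _).
  exists p; repeat split; [exists k; exact Hk|].
  intros r j -> [Hj _]; exists r, (r 0); repeat split; apply Hj.
Qed.

Lemma le_jump (f : problem) : f <=sW jump f.
Proof.
  apply (sW_le_intro _ _ (total_pfun (fun p => p)) (fun p => btuple (fun _ => p))).
  - apply total_pfun_computable; exact (recursive_oracle _ recursive_id).
  - unfold btuple; prove_recursive.
  - simpl; intros p x Hp Hx; exists x; split; [|split; [exact Hx|]].
    + exists p; split; [|exact Hp].
      intros k; exists 0; intros n _; now rewrite component_btuple.
    + intros r y Hr Hf; exists r, y; repeat split; assumption.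
Qed.

(** * Complexity of limits by closed choice *)

(** A number [z] is ruled out as code of a pair (n, w) at [t] by a mismatch of
    [phi n] at argument [t], or because some smaller index shows no mismatch
    below [w].  [miss i x] is nonzero at a mismatch. *)
Definition refuted (miss : nat -> nat -> nat) (z t : nat) : nat :=
  miss (nfst z) t +
  bsum (fun i => isz (bsum (miss i) (nsnd z))) (nfst z).

Lemma not_refuted_iff miss z :
  (forall t, refuted miss z t = 0) <->
  (forall t, miss (nfst z) t = 0) /\
  (forall i, i < nfst z -> exists x, x < nsnd z /\ miss i x <> 0).
Proof.
  unfold refuted; split.
  - intros H; split; [intros t; specialize (H t); lia|].
    intros i Hi; apply bsum_nonzero, isz_zero.
    specialize (H 0); apply Nat.eq_add_0 in H; destruct H as [_ H].
    rewrite bsum_zero in H; auto.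
  - intros [H H'] t; rewrite H; simpl; apply bsum_zero; intros i Hi.
    apply isz_zero, bsum_nonzero, H', Hi.
Qed.

(** The enumeration of refuted codes, shifted by one since stages without a
    refutation must enumerate something. *)
Definition refutations (miss : nat -> nat -> nat) (k : nat) : nat :=
  ifz (refuted miss (nfst k) (nsnd k)) 0 (S (nfst k)).

Lemma refutations_avoid miss z :
  (forall k, refutations miss k <> S z) <-> (forall t, refuted miss z t = 0).
Proof.
  unfold refutations; split.
  - intros H t; specialize (H (npair z t)); rewrite nfst_npair, nsnd_npair in H.
    destruct (refuted miss z t); [reflexivity|now destruct H].
  - intros H k E.
    destruct (refuted miss (nfst k) (nsnd k)) as [|r] eqn:Er; [discriminate|].
    injection E as E; rewrite E, H in Er; discriminate.
Qed.

Lemma goedel_number_final phi step final p i :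
  staging phi step final ->
  goedel_number phi p i <-> forall x, final i x = S (p x).
Proof.
  intros Hstep; split.
  - intros H x; apply (final_spec _ _ _ Hstep), H; reflexivity.
  - intros H x y; rewrite <- (final_spec _ _ _ Hstep), H.
    split; congruence.
Qed.

Lemma component_stages (u : nat -> nat -> nat) k :
  (fun s => component (fun n => u (nfst n) (nsnd n)) s k) = (fun s => u s k).
Proof.
  apply functional_extensionality; intros s; unfold component.
  now rewrite nfst_npair, nsnd_npair.
Qed.

(** Relative to the limit p of the input, being a Goedel number of p is a closed
    condition, since the limit stage decides halting.  Being minimal is not, but
    it becomes so when a bound for the places of the mismatches of the smaller
    indices is chosen along with the number. *)
Lemma jump_K_le_jump_C_N phi : acceptable phi -> jump (K phi) <=sW jump C_N.
Proof.
  intros Hphi; destruct (acceptable_staging _ Hphi) as (step & final & Hstep).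
  set (miss := fun r s i x => dist (step i x s) (S (component r s x))).
  set (limit_miss := fun (p : baire) i x => dist (final i x) (S (p x))).
  set (L := fun r n => refutations (miss r (nfst n)) (nsnd n)).
  apply (sW_le_intro _ _ (total_pfun (fun r n => nfst (pred (r n)))) L).
  - apply total_pfun_computable; prove_recursive.
  - unfold L, refutations, refuted, miss; prove_recursive.
  - simpl; intros r p0 [p [Hr ->]] [n Hn].
    assert (Hm : forall i x,
      converges (fun s => miss r s i x) (limit_miss p i x)).
    { intros i x; apply (converges_map2 (fun a b => dist a (S b))).
      - apply (step_converges _ _ _ Hstep).
      - exact (Hr x). }
    assert (Hspec : forall z, (forall t, refuted (limit_miss p) z t = 0) <->
      goedel_number phi p (nfst z) /\ forall i, i < nfst z ->
        exists x, x < nsnd z /\ limit_miss p i x <> 0).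
    { intros z; rewrite not_refuted_iff, (goedel_number_final _ _ _ _ _ Hstep).
      unfold limit_miss at 1; setoid_rewrite dist_zero; reflexivity. }
    assert (Hz : exists z, forall t, refuted (limit_miss p) z t = 0).
    { destruct Hn as [Hn Hmin].
      destruct (uniform_bound (fun i N =>
        exists x, x < N /\ limit_miss p i x <> 0) n) as [w Hw].
      - intros i N N' Hle (x & Hx & E); exists x; split; [lia|exact E].
      - intros i Hi; apply NNPP; intros H.
        assert (Hg : goedel_number phi p i).
        { apply (goedel_number_final _ _ _ _ _ Hstep); intros x.
          apply dist_zero, NNPP; intros E.
          apply H; exists (S x), x; split; [lia|exact E]. }
        apply Hmin in Hg; lia.
      - exists (npair n w); apply Hspec; rewrite nfst_npair, nsnd_npair; auto. }
    exists (refutations (limit_miss p)); split; [|split].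
    + exists (refutations (limit_miss p)); split; [|reflexivity].
      intros k; change (converges (fun s => component (L r) s k)
                          (refutations (limit_miss p) k)).
      unfold L; rewrite (component_stages (fun s => refutations (miss r s))).
      unfold refutations, refuted.
      apply converges_ifz; [|apply converges_const|apply converges_const].
      apply (converges_map2 Nat.add); [apply Hm|].
      apply converges_bsum; intros i; apply converges_map.
      apply converges_bsum; intros x; apply Hm.
    + destruct Hz as [z Hz]; exists (S z).
      exact (proj2 (refutations_avoid _ _) Hz).
    + intros q y -> Hy.
      exists (fun n => nfst (pred (q n))), (nfst (pred (q 0))).
      split; [reflexivity|]; split; [reflexivity|].
      destruct (q 0) as [|z].
      { destruct Hz as [z Hz]; destruct (Hy (npair z 0)).
        unfold refutations; now rewrite nfst_npair, Hz. }
      simpl.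
      destruct (proj1 (Hspec z) (proj1 (refutations_avoid _ _) Hy)) as [Hg Hlt].
      split; [exact Hg|]; intros i Hi.
      destruct (le_lt_dec (nfst z) i) as [|Hl]; [assumption|exfalso].
      destruct (Hlt i Hl) as (x & _ & E); apply E, dist_zero.
      exact (proj1 (goedel_number_final _ _ _ p i Hstep) Hi x).
Qed.

(** * Closed choice by complexity of limits *)

(** The candidate for a number outside the range of [q] moves on as soon as it
    has been enumerated. *)
Definition guess (q : baire) (t : nat) : nat :=
  nat_rect (fun _ => nat) 0
    (fun t m => ifz (bsum (fun u => isz (dist (q u) m)) (S t)) m (S m)) t.

Lemma guess_S q t :
  guess q (S t) = ifz (bsum (fun u => isz (dist (q u) (guess q t))) (S t))
                    (guess q t) (S (guess q t)).
Proof. reflexivity. Qed.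

Lemma guess_step q t :
  guess q (S t) = guess q t \/
  guess q (S t) = S (guess q t) /\ exists u, q u = guess q t.
Proof.
  rewrite guess_S; destruct (bsum _ _) eqn:E; cbn [ifz];
    [now left|right; split; [reflexivity|]].
  assert (H : bsum (fun u => isz (dist (q u) (guess q t))) (S t) <> 0) by lia.
  apply bsum_nonzero in H; destruct H as (u & _ & Hu).
  exists u; apply dist_zero; destruct (dist _ _); [reflexivity|].
  now destruct Hu.
Qed.

Lemma guess_stable q t u :
  u <= t -> guess q (S t) = guess q t -> q u <> guess q t.
Proof.
  intros Hu; rewrite guess_S.
  destruct (bsum _ _) eqn:E; cbn [ifz]; [intros _ Hq|lia].
  rewrite bsum_zero in E; specialize (E u); rewrite Hq in E.
  rewrite (proj2 (dist_zero _ _) eq_refl) in E; discriminate E; lia.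
Qed.

(** A candidate that is never enumerated is never left, so it bounds all. *)
Lemma guess_bound q n : (forall u, q u <> n) -> forall t, guess q t <= n.
Proof.
  intros Hn t; induction t as [|t IH]; [apply Nat.le_0_l|].
  destruct (guess_step q t) as [->|[-> [u Hu]]]; [assumption|].
  specialize (Hn u); lia.
Qed.

Lemma nondecreasing_bounded (f : nat -> nat) b :
  (forall t, f t <= f (S t)) -> (forall t, f t <= b) ->
  exists T, forall t, T <= t -> f t = f T.
Proof.
  intros Hmono.
  assert (Hle : forall T t, T <= t -> f T <= f t).
  { intros T t H; induction H as [|t _ IH]; [lia|].
    specialize (Hmono t); lia. }
  induction b as [|b IH]; intros Hb.
  - exists 0; intros t _; pose proof (Hb t); pose proof (Hb 0); lia.
  - destruct (classic (exists T, f T = S b)) as [[T HT]|H].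
    + exists T; intros t Ht; pose proof (Hle _ _ Ht); pose proof (Hb t); lia.
    + apply IH; intros t; specialize (Hb t).
      assert (f t <> S b) by (intros E; apply H; eauto); lia.
Qed.

Lemma guess_converges q n :
  (forall u, q u <> n) ->
  exists T, (forall t, T <= t -> guess q t = guess q T) /\
            forall u, q u <> guess q T.
Proof.
  intros Hn; destruct (nondecreasing_bounded (guess q) n) as [T HT].
  - intros t; destruct (guess_step q t) as [->|[-> _]]; lia.
  - now apply guess_bound.
  - exists T; split; [exact HT|]; intros u.
    rewrite <- (HT (T + u)) by lia; apply guess_stable; [lia|].
    rewrite (HT (S (T + u))), (HT (T + u)) by lia; reflexivity.
Qed.

Lemma recursive_guess Q T :
  recursive (fun p z => Q p (nfst z) (nsnd z)) -> recursive T ->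
  recursive (fun p x => guess (Q p x) (T p x)).
Proof.
  intros HQ HT; apply recursive_nat_rect; [prove_recursive| |assumption].
  apply recursive_ifz; [|prove_recursive|prove_recursive].
  apply recursive_bsum; [|prove_recursive].
  assert (HQ' : recursive (fun p z => Q p (nfst (nfst z)) (nsnd z))).
  { apply recursive_ext with (fun p z => Q p
      (nfst (npair (nfst (nfst z)) (nsnd z)))
      (nsnd (npair (nfst (nfst z)) (nsnd z)))).
    - intros p x; now rewrite nfst_npair, nsnd_npair.
    - apply (recursive_apply _ (fun p z => npair (nfst (nfst z)) (nsnd z)) HQ).
      prove_recursive. }
  prove_recursive.
Qed.

Lemma guess_continuous (r : nat -> baire) q t :
  (forall u, converges (fun s => r s u) (q u)) ->
  converges (fun s => guess (r s) t) (guess q t).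
Proof.
  intros H; induction t as [|t IH]; [exact (converges_const 0)|].
  
  change (fun s => guess (r s) (S t)) with (fun s =>
    ifz (bsum (fun u => isz (dist (r s u) (guess (r s) t))) (S t))
      (guess (r s) t) (S (guess (r s) t))).
  rewrite guess_S; apply converges_ifz; [| exact IH | exact (converges_map S _ _ IH)].
  apply converges_bsum; intros u.
  apply (converges_map2 (fun a b => isz (dist a b))); [apply H|exact IH].
Qed.

(** The value at the place (t, j) is a pair of the t-th candidate and a
    diagonalization against [phi j], active if the candidate changes after t and
    [j <= t].  As the diagonalization affects only finitely many places, the
    sequence is computable; as it refutes all [j <= t] at every change, the
    candidate no longer changes from the stage onwards whose number is the
    complexity of the sequence.
    [value j z] is [S y] if the j-th function has value y at z, and 0 if it is
    undefined. *)
Definition diagonal (q : baire) (value : nat -> nat -> nat) (z : nat) : nat :=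
  npair (guess q (nfst z))
    (ifz (dist (guess q (S (nfst z))) (guess q (nfst z))) 0
      (ifz (nsnd z - nfst z)
        (ifz (value (nsnd z) z) 0 (S (nsnd (pred (value (nsnd z) z))))) 0)).

Lemma diagonal_computable q value n :
  (forall u, q u <> n) -> recursive (fun _ => diagonal q value).
Proof.
  intros Hn; destruct (guess_converges q n Hn) as (T & HT & _).
  apply recursive_npair.
  - apply (recursive_apply (fun _ => guess q) (fun _ z => nfst z));
      [|prove_recursive].
    exact (recursive_eventually_constant _ T (guess q T) HT).
  - apply (recursive_eventually_constant _ (S (T + (T + T) * S (T + T))) 0).
    intros z Hz; destruct (le_lt_dec T (nfst z)) as [Hle|Hlt].
    + rewrite (proj2 (dist_zero _ _)); [reflexivity|].
      rewrite (HT (S (nfst z))), (HT (nfst z)) by lia; reflexivity.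
    + destruct (le_lt_dec (nsnd z) (nfst z)) as [H|H].
      * pose proof (npair_le (nfst z) (nsnd z) T); rewrite npair_surjective in *.
        lia.
      * destruct (dist _ _); [reflexivity|]; simpl.
        destruct (nsnd z - nfst z) eqn:E; [lia|reflexivity].
Qed.

Lemma diagonal_differs q value t j :
  guess q (S t) <> guess q t -> j <= t ->
  value j (npair t j) <> S (diagonal q value (npair t j)).
Proof.
  intros Hg Hj E; unfold diagonal in E.
  rewrite nfst_npair, nsnd_npair in E.
  rewrite <- dist_zero in Hg; destruct (dist _ _); [easy|].
  rewrite (proj2 (Nat.sub_0_le j t) Hj) in E; cbn [ifz] in E.
  destruct (value j (npair t j)) as [|v]; [discriminate|].
  injection E as E; apply (f_equal nsnd) in E; rewrite nsnd_npair in E.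
  simpl in E; lia.
Qed.

Lemma jump_C_N_le_jump_K phi : acceptable phi -> jump C_N <=sW jump (K phi).
Proof.
  intros Hphi; destruct (acceptable_staging _ Hphi) as (step & final & Hstep).
  set (L := fun r n => diagonal (component r (nfst n))
                         (fun j z => step j z (nfst n)) (nsnd n)).
  (* Only the complexity k is returned; as an index, it gives access to the
     sequence, whose entry at (k, 0) contains the k-th candidate. *)
  unshelve eapply (sW_le_intro _ _ (PFun (fun r q => exists y,
    phi (r 0) (npair (r 0) 0) y /\ q = fun _ => nfst y) _) L).
  - intros r q q' (y & Hy & ->) (y' & Hy' & ->).
    now rewrite (numbering_functional _ _ _ _ _ Hphi Hy Hy').
  - destruct (acceptable_utm _ Hphi) as [c Hc].
    assert (H : recursive (fun p _ => npair (p 0) (npair (p 0) 0)))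
      by prove_recursive.
    destruct H as [d Hd].
    exists (CComp CFst (CComp (erase c) d)); intros r q (y & Hy & ->) n.
    exists y; split; [|reflexivity]; eexists; split; [apply Hd|].
    apply eval_erase, Hc; now rewrite nfst_npair, nsnd_npair.
  - unfold L, diagonal.
    assert (H1 : recursive (fun p n =>
      guess (component p (nfst n)) (nfst (nsnd n)))).
    { apply (recursive_guess (fun p n => component p (nfst n)));
        prove_recursive. }
    assert (H2 : recursive (fun p n =>
      guess (component p (nfst n)) (S (nfst (nsnd n))))).
    { apply (recursive_guess (fun p n => component p (nfst n)));
        prove_recursive. }
    prove_recursive.
  - simpl; intros r q0 [q [Hr ->]] [n Hn].
    set (p := diagonal q final).
    destruct (guess_converges q n Hn) as (T & HT & Hout).
    destruct (recursive_goedel_number phi p Hphi) as [i Hi];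
      [exact (diagonal_computable _ _ _ Hn)|].
    destruct (complexity_exists _ _ _ Hi) as (k & Hk & _).
    exists p; split; [|split; [exists k; exact Hk|]].
    + exists p; split; [|reflexivity]; intros z.
      change (converges (fun s => component (L r) s z) (p z)).
      unfold L; rewrite (component_stages (fun s => diagonal (component r s)
        (fun j z => step j z s))).
      assert (Hg : forall t,
        converges (fun s => guess (component r s) t) (guess q t))
        by (intros t; apply guess_continuous; exact Hr).
      pose proof (step_converges _ _ _ Hstep (nsnd z) z) as Hs.
      apply (converges_map2 npair); [apply Hg|].
      apply converges_ifz; [|apply converges_const|].
      * apply (converges_map2 dist); apply Hg.
      * apply converges_ifz; [apply converges_const| |apply converges_const].
        apply (converges_map (fun a => ifz a 0 (S (nsnd (pred a)))) _ _ Hs).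
    + intros a b -> [Ha _].
      exists (fun _ => guess q (a 0)), (guess q (a 0)).
      split; [|split; [reflexivity|]].
      * exists (p (npair (a 0) 0)); split; [now apply Ha|].
        unfold p, diagonal; now rewrite !nfst_npair.
      * assert (E : forall d, guess q (d + a 0) = guess q (a 0)).
        { induction d as [|d IH]; [reflexivity|]; rewrite <- IH.
          apply NNPP; intros H.
          apply (diagonal_differs q final (d + a 0) (a 0) H); [lia|].
          apply (proj1 (goedel_number_final _ _ _ p _ Hstep) Ha). }
        rewrite <- (E T), HT by lia; exact Hout.
Qed.

(** * Names of finite tuples *)

Lemma Forall2_map_seq {X Y} (R : X -> Y -> Prop) (f : nat -> X) n l d :
  Forall2 R (map f (seq 0 n)) l <->
  length l = n /\ forall i, i < n -> R (f i) (nth i l d).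
Proof.
  revert n f; induction l as [|y l IH]; intros [|n] f; simpl.
  - split; [intros _; split; [reflexivity|lia]|constructor].
  - split; [intros H; inversion H|intros [H _]; discriminate].
  - split; [intros H; inversion H|intros [H _]; discriminate].
  - rewrite <- seq_shift, map_map; split.
    + intros H; inversion H as [|? ? ? ? H0 Hl]; subst.
      apply IH in Hl; destruct Hl as [<- Hl]; split; [reflexivity|].
      intros [|i] Hi; [exact H0|apply Hl; lia].
    + intros [[= <-] H]; constructor; [apply (H 0); lia|].
      apply IH; split; [reflexivity|]; intros i Hi; apply (H (S i)); lia.
Qed.

Lemma Forall2_total {X Y} (R : X -> Y -> Prop) l :
  (forall x, exists y, R x y) -> exists l', Forall2 R l l'.
Proof.
  intros H; induction l as [|x l [l' IH]]; [now exists nil|].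
  destruct (H x) as [y Hy]; exists (y :: l'); now constructor.
Qed.

Definition entry (p : baire) (i t : nat) : nat := p (S (npair i t)).

Definition tuple_of (p : baire) : list baire :=
  map (component (fun k => p (S k))) (seq 0 (p 0)).

Lemma rep_tuple_of p : rep (seq_space baire_space) p (tuple_of p).
Proof.
  simpl; fold (tuple_of p); induction (tuple_of p); constructor; auto.
Qed.

Lemma rep_tuple_unique p l : rep (seq_space baire_space) p l -> l = tuple_of p.
Proof. intros H; exact (graph_functional _ H (rep_tuple_of p)). Qed.

Lemma b2n_nonzero b : Nat.b2n b <> 0 <-> b = true.
Proof. destruct b; simpl; split; congruence. Qed.

Lemma rep_bits p (bs : list bool) :
  rep (seq_space bool_space) p bs <->
  length bs = p 0 /\
  forall i, i < p 0 -> Nat.b2n (nth i bs true) = entry p i 0.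
Proof. exact (Forall2_map_seq (rep bool_space) _ _ bs true). Qed.

Lemma star_LPO_tuple p (bs : list bool) :
  star LPO (tuple_of p) bs <->
  length bs = p 0 /\
  forall i, i < p 0 -> (nth i bs true = true <-> forall t, entry p i t = 0).
Proof. exact (Forall2_map_seq (values LPO) _ _ bs true). Qed.

Lemma star_LPO_total xs : dom (star LPO) xs.
Proof.
  apply (Forall2_total (values LPO)); intros p.
  destruct (classic (forall n, p n = 0)) as [H|H].
  - now exists true.
  - exists false; simpl; split; [discriminate|contradiction].
Qed.

(** * Merging the consistent programs below a bound *)

(** A tuple of bits becomes a single number listing the indices [i], as [S i],
    of its nonzero bits. *)
Definition index_list (p : baire) (n : nat) : nat :=
  nat_rect (fun _ => nat) 0
    (fun i l => npair (ifz (entry p i 0) 0 (S i)) l) n.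

Definition list_item (l j : nat) : nat :=
  nfst (nat_rect (fun _ => nat) l (fun _ l' => nsnd l') j).

Lemma list_item_cons a l j :
  list_item (npair a l) (S j) = list_item l j.
Proof.
  unfold list_item; f_equal; induction j as [|j IH]; simpl in *.
  - apply nsnd_npair.
  - now rewrite IH.
Qed.

Lemma list_item_index_list p n i :
  (exists j, list_item (index_list p n) j = S i) <->
  i < n /\ entry p i 0 <> 0.
Proof.
  induction n as [|n IH].
  - split; [|lia]; intros [j E]; exfalso; revert E.
    assert (E0 : nfst 0 = 0) by reflexivity.
    assert (E1 : nsnd 0 = 0) by reflexivity.
    unfold list_item, index_list; simpl.
    replace (nat_rect _ 0 _ j) with 0; [now rewrite E0|].
    induction j as [|j IH]; simpl; [reflexivity|now rewrite <- IH].
  - change (index_list p (S n))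
      with (npair (ifz (entry p n 0) 0 (S n)) (index_list p n)); split.
    + intros [[|j] E].
      * unfold list_item in E; simpl in E; rewrite nfst_npair in E.
        destruct (entry p n 0) eqn:En; simpl in E; [discriminate|].
        injection E as <-; lia.
      * rewrite list_item_cons in E; destruct (proj1 IH) as [H H']; [eauto|].
        split; [lia|exact H'].
    + intros [Hi E]; destruct (Nat.eq_dec i n) as [->|].
      * exists 0; unfold list_item; simpl; rewrite nfst_npair.
        destruct (entry p n 0); [easy|reflexivity].
      * destruct (proj2 IH) as [j Hj]; [split; [lia|exact E]|].
        exists (S j); now rewrite list_item_cons.
Qed.

Lemma recursive_index_list N :
  recursive N -> recursive (fun p x => index_list p (N p x)).
Proof.
  intros HN; apply recursive_nat_rect; [prove_recursive| |assumption].
  unfold entry; prove_recursive.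
Qed.

Lemma recursive_list_item A B :
  recursive A -> recursive B ->
  recursive (fun p x => list_item (A p x) (B p x)).
Proof. intros HA HB; unfold list_item; prove_recursive. Qed.

(** By dovetailing, the programs in a list are merged into one that outputs the
    first value found; the s-m-n property gives its index. *)
Lemma merge_programs phi :
  acceptable phi ->
  exists s, recursive (fun _ => s) /\
    forall l p,
      (forall i j, list_item l j = S i ->
         forall x y, phi i x y -> y = p x) ->
      (exists i j, list_item l j = S i /\ goedel_number phi p i) ->
      goedel_number phi p (s l).
Proof.
  intros Hphi; destruct (acceptable_staging _ Hphi) as (step & final & Hstep).
  (* [z] is made of the list, the argument, and a pair of a place in the list
     and a stage *)
  set (try z := ifz (list_item (nfst (nfst z)) (nfst (nsnd z))) 0
    (step (pred (list_item (nfst (nfst z)) (nfst (nsnd z))))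
       (nsnd (nfst z)) (nsnd (nsnd z)))).
  assert (Htry : recursive (fun _ => try)).
  { unfold try.
    assert (H : recursive (fun _ z =>
      list_item (nfst (nfst z)) (nfst (nsnd z))))
      by (apply recursive_list_item; prove_recursive).
    prove_recursive. }
  assert (Hsearch : recursive (fun _ z => isz (try z))) by prove_recursive.
  destruct Hsearch as [c Hc].
  assert (Hvalue : recursive (fun _ z => pred (try z)))
    by prove_recursive.
  destruct Hvalue as [d Hd].
  destruct recursive_id as [e He].
  set (merged := CComp d (CPair e (CMu c))).
  destruct (acceptable_smn _ Hphi (eval merged (fun _ => 0)))
    as (s & Hs & Hphis); [exists merged; reflexivity|].
  exists s; split; [now apply recursive_of_total_computable|].
  intros l p Hcons (i & j & Hj & Hi) x.
  assert (Hp : phi (s l) x (p x)).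
  { destruct (eval_CMu c (fun z => isz (try z)) (fun _ => 0) (npair l x))
      as (w & Hw & Hwz); [apply Hc| |].
    - destruct (step_converges _ _ _ Hstep i x) as [N HN].
      exists (npair j N); apply isz_zero; unfold try.
      autorewrite with npair; rewrite Hj; cbn [ifz pred].
      rewrite HN, (proj1 (goedel_number_final _ _ _ p i Hstep) Hi) by lia.
      discriminate.
    - apply Hphis; unfold merged; cbn [eval].
      exists (npair (npair l x) w); split.
      + exists (npair l x), w; split; [apply He|split; [exact Hw|reflexivity]].
      + replace (p x) with (pred (try (npair (npair l x) w))); [apply Hd|].
        apply isz_zero in Hwz; revert Hwz; unfold try.
        autorewrite with npair.
        destruct (list_item l (nfst w)) as [|i'] eqn:Ei; cbn [ifz pred]; [easy|].
        destruct (step i' x (nsnd w)) as [|y] eqn:Ey; [easy|]; intros _; simpl.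
        apply (Hcons _ _ Ei), (step_sound _ _ _ Hstep _ _ _ _ Ey). }
  intros y; split; [|intros <-; exact Hp].
  exact (numbering_functional _ _ _ _ _ Hphi Hp).
Qed.

(** Whether a program ever contradicts p is a question about one sequence, while
    whether it computes p is not.  The former suffices, because programs that
    never contradict p can be merged without knowing which of them is total. *)
Lemma G_ge_le_star_LPO phi : acceptable phi -> G_ge phi <=sW star LPO.
Proof.
  intros Hphi; destruct (acceptable_staging _ Hphi) as (step & final & Hstep).
  destruct (merge_programs _ Hphi) as (s & Hs & Hmerge).
  (* the i-th instance has a nonzero entry if some stage of the i-th program
     contradicts p *)
  set (clash := fun (r : baire) i t =>
    ifz (step i (nfst t) (nsnd t)) 0
      (dist (step i (nfst t) (nsnd t)) (S (bfst r (nfst t))))).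
  set (L := fun r n => ifz n (S (bsnd r 0))
    (clash r (nfst (pred n)) (nsnd (pred n)))).
  apply (sW_le_intro _ _
    (total_pfun (fun r _ => s (index_list r (r 0)))) L).
  - apply total_pfun_computable.
    apply (recursive_apply (fun _ => s)); [exact Hs|].
    apply recursive_index_list; prove_recursive.
  - unfold L, clash; prove_recursive.
  - intros r [p m] [Hp Hm] (i & (k & [Hk Hkmin] & Hkm) & _).
    simpl in Hp, Hm, Hk, Hkm; subst p m.
    exists (tuple_of (L r)); split; [apply rep_tuple_of|].
    split; [apply star_LPO_total|].
    intros q bs Hq Hbs.
    apply rep_bits in Hq; apply star_LPO_tuple in Hbs.
    change (L r 0) with (S (bsnd r 0)) in Hbs.
    destruct Hq as [Hlen Hq], Hbs as [Hlen' Hbs].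
    rewrite Hlen in Hlen'; rewrite Hlen' in Hq.
    exists (fun _ => s (index_list q (q 0))), (s (index_list q (q 0))).
    split; [reflexivity|]; split; [reflexivity|].
    assert (Hbit : forall j, j < S (bsnd r 0) ->
      (entry q j 0 <> 0 <-> forall x y, phi j x y -> y = bfst r x)).
    { intros j Hj; rewrite <- Hq by exact Hj.
      rewrite b2n_nonzero, Hbs by exact Hj.
      assert (HL : forall t, entry (L r) j t = clash r j t).
      { intros t; unfold entry, L; simpl.
        now rewrite nfst_npair, nsnd_npair. }
      setoid_rewrite HL; unfold clash; split.
      - intros H x y Hy; apply (final_spec _ _ _ Hstep) in Hy.
        destruct (step_converges _ _ _ Hstep j x) as [N HN].
        specialize (H (npair x N)); rewrite nfst_npair, nsnd_npair in H.
        rewrite HN, Hy in H by lia; apply (proj1 (dist_zero _ _)) in H; congruence.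
      - intros H t; destruct (step j (nfst t) (nsnd t)) as [|y] eqn:E;
          [reflexivity|].
        apply dist_zero; f_equal; apply H.
        exact (step_sound _ _ _ Hstep _ _ _ _ E). }
    split; [exists k; split; [split; assumption|assumption]|].
    rewrite Hlen'; apply Hmerge.
    + intros j j' E; destruct (proj1 (list_item_index_list _ _ _)
        (ex_intro _ j' E)) as [Hj Hne].
      now apply Hbit.
    + exists k; destruct (proj2 (list_item_index_list q (S (bsnd r 0)) k))
        as [j Hj]; [split; [lia|]|exists j; now split].
      apply Hbit; [lia|]; intros x y Hy; symmetry; now apply Hk.
Qed.

(** * Finitely many questions and closed choice *)

(** A number [v] is enumerated, hence not an answer, when a sequence of the tuple has a
    nonzero entry, but none before place [v]; an answer is thus a place before
    which every nonzero sequence of the tuple has shown a nonzero entry.  The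
    value 0 serves to pad the enumeration. *)
Lemma star_LPO_le_C_N : W_le (star LPO) C_N.
Proof.
  set (L := fun p k =>
    ifz (S (nfst (nsnd k)) - p 0)
      (ifz (entry p (nfst (nsnd k)) (nsnd (nsnd k))) 0
         (ifz (bsum (entry p (nfst (nsnd k))) (nfst k)) (nfst k) 0)) 0).
  set (H := fun r n => ifz n (bfst r 0)
    (isz (bsum (entry (bfst r) (nfst (pred n))) (bsnd r 0)))).
  apply (W_le_intro _ _ H L).
  - unfold H, entry; prove_recursive.
  - unfold L, entry; prove_recursive.
  - intros p xs Hp _; apply rep_tuple_unique in Hp; subst xs.
    assert (Hspec : forall v, v <> 0 -> ((forall k, L p k <> v) <->
      forall i, i < p 0 -> (exists t, entry p i t <> 0) ->
        exists t, t < v /\ entry p i t <> 0)).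
    { intros v Hv; split.
      - intros Hout i Hi [t Ht]; apply bsum_nonzero; intros E.
        apply (Hout (npair v (npair i t))); unfold L.
        autorewrite with npair; rewrite E.
        destruct (S i - p 0) eqn:Ei; [|lia].
        now destruct (entry p i t).
      - intros Hw k; unfold L.
        destruct (S _ - p 0) eqn:Ei; simpl; [|lia].
        destruct (entry p _ (nsnd _)) eqn:Et; simpl; [lia|].
        destruct (bsum _ _) eqn:Es; simpl; [|lia].
        intros <-; destruct (Hw (nfst (nsnd k))) as (t & Ht & Ht'); [lia| |].
        + exists (nsnd (nsnd k)); lia.
        + rewrite bsum_zero in Es; auto. }
    exists (L p); split; [reflexivity|split].
    + destruct (uniform_bound (fun i N => (exists t, entry p i t <> 0) ->
        exists t, t < N /\ entry p i t <> 0) (p 0)) as [N HN].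
      { intros i N N' Hle HN Ht; destruct (HN Ht) as (t & Ht' & E).
        exists t; split; [lia|exact E]. }
      { intros i _; destruct (classic (exists t, entry p i t <> 0))
          as [[t Ht]|Hn].
        - exists (S t); intros _; exists t; split; [lia|exact Ht].
        - exists 0; contradiction. }
      exists (S N); refine (proj2 (Hspec (S N) (Nat.neq_succ_0 N)) _).
      intros i Hi Ht; destruct (HN i Hi Ht) as (t & Ht' & E).
      exists t; split; [lia|exact E].
    + intros r v Hrv Hv; simpl in Hrv, Hv; subst v.
      assert (Hr : r 0 <> 0).
      { intros E; apply (Hv (npair 0 0)); unfold L.
        autorewrite with npair; rewrite E.
        destruct (_ - _); [|reflexivity].
        now destruct (entry _ _ _). }
      pose proof (proj1 (Hspec _ Hr) Hv) as Hw.
      set (bit i := Nat.eqb (bsum (entry p i) (r 0)) 0).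
      assert (Hbit : forall i, i < p 0 ->
        nth i (map bit (seq 0 (p 0))) true = bit i).
      { intros i Hi; rewrite nth_indep with (d' := bit 0)
          by now rewrite length_map, length_seq.
        now rewrite map_nth, seq_nth. }
      exists (map bit (seq 0 (p 0))); split.
      * apply rep_bits; change (H (bpair p r) 0) with (bfst (bpair p r) 0).
        rewrite bfst_bpair, length_map, length_seq; split; [reflexivity|].
        intros i Hi; rewrite Hbit by exact Hi.
        unfold entry at 1, H, bit; simpl.
        rewrite bfst_bpair, bsnd_bpair, nfst_npair.
        now destruct (bsum (entry p i) (r 0)).
      * apply star_LPO_tuple; rewrite length_map, length_seq.
        split; [reflexivity|]; intros i Hi; rewrite Hbit by exact Hi.
        unfold bit; rewrite Nat.eqb_eq, bsum_zero; split; [|auto].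
        intros Hz t; apply NNPP; intros Ht.
        destruct (Hw i Hi) as (t' & Ht' & E); [eauto|]; auto.
Qed.

(** Canonical names, making the answers of an oracle for finitely many questions
    depend on the answered bits alone. *)
Definition bits_name (bs : list bool) : baire := fun n =>
  match n with
  | 0 => length bs
  | S k => Nat.b2n (nth (nfst k) bs true)
  end.

Lemma rep_bits_name bs : rep (seq_space bool_space) (bits_name bs) bs.
Proof.
  apply rep_bits; split; [reflexivity|]; intros i _.
  unfold entry; simpl; now rewrite nfst_npair.
Qed.

Lemma LPO_bits_unique p (bs bs' : list bool) :
  star LPO (tuple_of p) bs -> star LPO (tuple_of p) bs' -> bs = bs'.
Proof.
  rewrite !star_LPO_tuple; intros [Hlen H] [Hlen' H'].
  apply (nth_ext _ _ true true); [congruence|].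
  intros i Hi; rewrite Hlen in Hi; specialize (H i Hi); specialize (H' i Hi).
  rewrite <- H' in H.
  destruct (nth i bs true), (nth i bs' true); intuition congruence.
Qed.

Definition canonical_LPO_realizer : pfun baire baire.
Proof.
  refine (PFun (fun p q => exists bs, star LPO (tuple_of p) bs /\
                                      q = bits_name bs) _).
  intros p q q' (bs & Hbs & ->) (bs' & Hbs' & ->).
  now rewrite (LPO_bits_unique _ _ _ Hbs Hbs').
Defined.

Lemma canonical_LPO_realizes : realizes canonical_LPO_realizer (star LPO).
Proof.
  intros p xs Hp [bs Hbs]; apply rep_tuple_unique in Hp; subst xs.
  exists (bits_name bs), bs; split; [exists bs; now split|].
  split; [apply rep_bits_name|exact Hbs].
Qed.

Definition falses (bs : list bool) : nat := count_occ Bool.bool_dec bs false.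

Lemma falses_le_length bs : falses bs <= length bs.
Proof. apply count_occ_bound. Qed.

Lemma falses_maximal bs bs' :
  length bs = length bs' ->
  (forall i, i < length bs -> nth i bs true = false -> nth i bs' true = false) ->
  falses bs' <= falses bs -> bs = bs'.
Proof.
  assert (Hle : forall bs bs', length bs = length bs' ->
    (forall i, i < length bs ->
       nth i bs true = false -> nth i bs' true = false) ->
    falses bs <= falses bs' /\ (falses bs' <= falses bs -> bs = bs')).
  { clear; induction bs as [|b bs IH]; intros [|b' bs']; try discriminate.
    - split; [lia|reflexivity].
    - intros [= Hlen] H; destruct (IH bs' Hlen) as [Hle Heq].
      { intros i Hi; apply (H (S i)); simpl; lia. }
      specialize (H 0); simpl in H; unfold falses in *.
      destruct b, b'; simpl in *.
      1, 4: split; [lia|intros; f_equal; apply Heq; lia].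
      + split; lia.
      + discriminate H; [lia|reflexivity]. }
  intros Hlen H; now apply Hle.
Qed.

Lemma eventually_constant_dom q N v :
  (forall k, N <= k -> q k = v) -> dom C_N q.
Proof.
  intros H; destruct (uniform_bound (fun k B => q k < B) N) as [B HB].
  - intros m B B' Hle; lia.
  - intros m _; exists (S (q m)); lia.
  - exists (S (B + v)); intros k; destruct (le_lt_dec N k) as [Hk|Hk].
    + rewrite H by exact Hk; lia.
    + specialize (HB k Hk); lia.
Qed.

Lemma bpair_prefix N q q' r :
  (forall k, k < N -> q' k = q k) ->
  forall k, k < N -> bpair q' r k = bpair q r k.
Proof.
  intros H k Hk; unfold bpair; destruct (Nat.even k); [|reflexivity].
  apply H; pose proof (Nat.div2_decr k k); lia.
Qed.

(** A reduction asks a number of questions that depends on a prefix of its input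
    only.  A positive answer, that is the bit [false], persists under changes of
    the input far out, so on a neighbourhood of an input with the most positive
    answers the bits do not change at all.  There the output depends on the
    input alone, continuously, and a number can be enumerated after it has been
    chosen. *)
Lemma C_N_not_le_star_LPO : ~ W_le C_N (star LPO).
Proof.
  intros (H & L & [h Hh] & [l Hl] & Hred).
  specialize (Hred _ canonical_LPO_realizes).
  assert (Hrun : forall q, dom C_N q -> exists p (bs : list bool) v,
    (forall n, eval l q n (p n)) /\ star LPO (tuple_of p) bs /\
    eval h (bpair q (bits_name bs)) 0 v /\ forall k, q k <> v).
  { intros q Hq.
    destruct (Hred q q eq_refl Hq)
      as (out & v & (u & (r & (p & Hp & bs & Hbs & ->) & ->) & Hout) & Hv & Hc).
    simpl in Hv, Hc; subst v.
    exists p, bs, (out 0); repeat split; [|exact Hbs| |exact Hc].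
    - intros n; exact (Hl _ _ Hp n).
    - exact (Hh _ _ Hout 0). }
  destruct (Hrun (fun _ => 0)) as (p0 & _ & _ & Hp0 & _).
  { apply (eventually_constant_dom _ 0 0); reflexivity. }
  destruct (eval_continuous _ _ _ _ (Hp0 0)) as [N0 HN0].
  (* the minimal [c] belongs to an input with the most positive answers *)
  set (count := fun c => exists q p (bs : list bool), dom C_N q /\
    (forall k, k < N0 -> q k = 0) /\ (forall n, eval l q n (p n)) /\
    star LPO (tuple_of p) bs /\ p0 0 = c + falses bs).
  destruct (least_witness count) as (c & (q & p & bs & Hq & HqN & Hp & Hbs & Hc)
    & Hmin).
  { destruct (Hrun (fun _ => 0)) as (p & bs & _ & Hp & Hbs & _).
    - apply (eventually_constant_dom _ 0 0); reflexivity.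
    - exists (p0 0 - falses bs), (fun _ => 0), p, bs; repeat split; auto.
      + apply (eventually_constant_dom _ 0 0); reflexivity.
      + pose proof (falses_le_length bs) as Hle.
        apply star_LPO_tuple in Hbs; destruct Hbs as [Hlen _].
        rewrite Hlen, (eval_functional _ _ _ _ _ (Hp 0) (Hp0 0)) in Hle; lia. }
  assert (Hlength : forall q' p' (bs' : list bool), (forall k, k < N0 -> q' k = 0) ->
    (forall n, eval l q' n (p' n)) -> star LPO (tuple_of p') bs' ->
    p' 0 = p0 0 /\ length bs' = p0 0).
  { intros q' p' bs' Hq' Hp' Hbs'.
    assert (E : p' 0 = p0 0)
      by exact (eval_functional _ _ _ _ _ (Hp' 0) (HN0 _ Hq')).
    split; [exact E|]; rewrite <- E; now apply star_LPO_tuple. }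
  destruct (Hlength _ _ _ HqN Hp Hbs) as [Hp0' Hlen].
  destruct (Hrun q Hq) as (p' & bs' & v & Hp' & Hbs' & Hv & Hout).
  assert (E : p' = p).
  { apply functional_extensionality; intros n.
    exact (eval_functional _ _ _ _ _ (Hp' n) (Hp n)). }
  subst p'; rewrite (LPO_bits_unique _ _ _ Hbs' Hbs) in Hv; clear bs' Hbs' Hp'.
  destruct (uniform_bound (fun i N => nth i bs true = false ->
    exists t y, y <> 0 /\ forall q', (forall k, k < N -> q' k = q k) ->
      eval l q' (S (npair i t)) y) (p 0)) as [N1 HN1].
  { intros i N N' Hle HN Hi; destruct (HN Hi) as (t & y & Hy & Ht).
    exists t, y; split; [exact Hy|]; intros q' Hq'; apply Ht.
    intros; apply Hq'; lia. }
  { intros i Hi; destruct (classic (forall t, entry p i t = 0)) as [Hz|Hz].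
    - exists 0; intros Hf; apply star_LPO_tuple in Hbs.
      apply Hbs in Hz; [congruence|exact Hi].
    - apply not_all_ex_not in Hz; destruct Hz as [t Ht].
      destruct (eval_continuous _ _ _ _ (Hp (S (npair i t)))) as [N HN].
      exists N; intros _; exists t, (entry p i t); split; [exact Ht|exact HN]. }
  destruct (eval_continuous _ _ _ _ Hv) as [N2 HN2].
  set (M := N0 + N1 + N2).
  set (q' := fun k => if lt_dec k M then q k else v).
  assert (Hpre : forall k, k < M -> q' k = q k)
    by (intros k Hk; unfold q'; destruct (lt_dec k M); [reflexivity|lia]).
  assert (Hpost : forall k, M <= k -> q' k = v)
    by (intros k Hk; unfold q'; destruct (lt_dec k M); [lia|reflexivity]).
  pose proof (eventually_constant_dom _ _ _ Hpost) as Hq'.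
  assert (HqN' : forall k, k < N0 -> q' k = 0)
    by (intros k Hk; rewrite Hpre by lia; auto).
  destruct (Hrun q' Hq') as (p' & bs' & v' & Hp' & Hbs' & Hv' & Hout').
  destruct (Hlength _ _ _ HqN' Hp' Hbs') as [Hp0'' Hlen'].
  assert (E : bs = bs').
  { apply falses_maximal; [now rewrite Hlen|..].
    - intros i Hi Hf; rewrite Hlen, <- Hp0' in Hi.
      destruct (HN1 i Hi Hf) as (t & y & Hy & Ht).
      destruct (nth i bs' true) eqn:Ei; [exfalso|reflexivity].
      apply star_LPO_tuple in Hbs'; destruct Hbs' as [_ Hbs'].
      rewrite Hbs' in Ei by congruence.
      apply Hy; rewrite <- (Ei t).
      apply (eval_functional l q' (S (npair i t))); [|apply Hp'].
      apply Ht; intros; apply Hpre; lia.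
    - pose proof (falses_le_length bs') as Hle; rewrite Hlen' in Hle.
      assert (Hcount : count (p0 0 - falses bs')).
      { exists q', p', bs'; repeat split; auto; lia. }
      apply Hmin in Hcount; lia. }
  subst bs'; apply (Hout' M); rewrite Hpost by lia.
  apply (eval_functional h (bpair q' (bits_name bs)) 0); [|exact Hv'].
  apply HN2, bpair_prefix; intros; apply Hpre; lia.
Qed.

Theorem proposition19 (phi : numbering) (Hphi : acceptable phi) :
  (K_ge phi <=sW G phi /\
   G phi <=sW K phi /\
   K phi <=sW jump (K phi) /\
   jump (K phi) ==sW jump C_N) /\
  (G_ge phi <=sW star LPO /\
   star LPO <W C_N).
Proof.
  split; [|split].
  - split; [apply K_ge_le_G|]; split; [apply G_le_K|]; split; [apply le_jump|].
    split; [now apply jump_K_le_jump_C_N|now apply jump_C_N_le_jump_K].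
  - now apply G_ge_le_star_LPO.
  - split; [exact star_LPO_le_C_N|exact C_N_not_le_star_LPO].
Qed.
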